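(* If $T$ and $T'$ are trees which are not $3$-peripheral with $|T|,|T'|\ge 2$ and $\operatorname{diam}(T\square T')$ is odd, then $\operatorname{aw}(T\square T',3)=4$.
   Context: All graphs are finite, simple, undirected and connected; $|G|$ denotes the number of vertices of $G$. $\operatorname{d}_G(u,v)$ (or $\operatorname{d}(u,v)$) is the length of a shortest $u$-$v$ path in $G$, and $\operatorname{diam}(G)$ is the maximum distance between pairs of vertices of $G$. A graph $G$ is $n$-peripheral if it contains $n$ (distinct) vertices $u_1,\dots,u_n$ with $\operatorname{d}(u_i,u_j)=\operatorname{diam}(G)$ for all distinct $i,j\in\{1,\dots,n\}$; it is not $n$-peripheral if no such $n$ vertices exist. The Cartesian product $G\square H$ has vertex set $V(G)\times V(H)$, with $(x,y)$ and $(x',y')$ adjacent iff either $x=x'$ and $yy'\in E(H)$, or $y=y'$ and $xx'\in E(G)$. A $k$-term arithmetic progression ($k$-AP) in $G$ is a set of vertices $\{v_1,\dots,v_k\}$ for which there is a $d$ with $\operatorname{d}(v_i,v_{i+1})=d$ for all $1\le i\le k-1$. An exact $r$-coloring of $G$ is a surjective function $c:V(G)\to\{1,\dots,r\}$. A $k$-AP $\{v_1,\dots,v_k\}$ is rainbow under $c$ if $c(v_i)\ne c(v_j)$ whenever $i\neq j$. The anti-van der Waerden number $\operatorname{aw}(G,k)$ is the least positive integer $r$ such that every exact $r$-coloring of $G$ contains a rainbow $k$-AP (if no coloring of the vertices yields a rainbow $k$-AP, then $\operatorname{aw}(G,k)=|V(G)|+1$). *)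

(* Defs.v *)
From mathcomp Require Import all_boot.
From mathcomp Require Import boolp.

Set Implicit Arguments.
Unset Strict Implicit.
Unset Printing Implicit Defensive.

Section Graphs.
Variables (V : finType) (e : rel V).

Definition simple_graph : Prop := symmetric e /\ irreflexive e.

Definition connected_graph : Prop := forall x y : V, connect e x y.

(* [ucycle e [:: x; y]] holds whenever [x] and [y] are adjacent; genuine cycles
   have at least three vertices. *)
Definition acyclic_graph : Prop := forall s : seq V, ucycle e s -> size s < 3.

Definition tree : Prop :=
  [/\ simple_graph, connected_graph & acyclic_graph].

Definition has_path (x y : V) (n : nat) : bool :=
  [exists p : n.-tuple V, [&& path e x p, last x p == y & uniq (x :: p)]].

(* A path has length at most [#|V|.-1], so the search range is large enough;
   the junk value is [#|V|] when [x] and [y] are not connected. *)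
Definition dist (x y : V) : nat := find (has_path x y) (iota 0 #|V|).

Definition diam : nat := \max_(x : V) \max_(y : V) dist x y.

Definition peripheral (n : nat) : Prop :=
  exists u : 'I_n -> V,
    injective u /\ forall i j : 'I_n, i != j -> dist (u i) (u j) = diam.

(* An arithmetic progression is given by the listing [v_1, ..., v_k] of its
   vertices, on which both the distance condition and rainbowness are stated. *)
Definition arith_prog (k : nat) (v : 'I_k -> V) : Prop :=
  exists d : nat,
    forall i j : 'I_k, nat_of_ord j = i.+1 -> dist (v i) (v j) = d.

Definition exact_coloring (r : nat) (c : V -> 'I_r) : Prop :=
  forall a : 'I_r, exists x : V, c x = a.

Definition rainbow (r k : nat) (c : V -> 'I_r) (v : 'I_k -> V) : Prop :=
  forall i j : 'I_k, i != j -> c (v i) != c (v j).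

Definition has_rainbow_ap (r k : nat) (c : V -> 'I_r) : Prop :=
  exists v : 'I_k -> V, arith_prog v /\ rainbow c v.

Definition forces_rainbow (k r : nat) : Prop :=
  forall c : V -> 'I_r, exact_coloring c -> has_rainbow_ap k c.

Lemma exact_coloring_leq (r : nat) (c : V -> 'I_r) :
  exact_coloring c -> r <= #|V|.
Proof.
move=> cS; have [f fK] := choice cS.
by rewrite -[r]card_ord -(card_codom (can_inj fK)) max_card.
Qed.

Lemma forces_rainbow_ex (k : nat) :
  exists r : nat, (0 < r) && `[< forces_rainbow k r >].
Proof.
exists #|V|.+1 => /=; apply/asboolP => c /exact_coloring_leq.
by rewrite ltnn.
Qed.

(* There is no exact coloring with [#|V|.+1] colors, so this minimum exists and
   equals [#|V|.+1] when no coloring has a rainbow progression (see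
   [aw_no_rainbow]). *)
Definition aw (k : nat) : nat := ex_minn (forces_rainbow_ex k).

Lemma awP (k r : nat) :
  aw k = r <-> [/\ 0 < r, forces_rainbow k r &
    forall s, 0 < s -> forces_rainbow k s -> r <= s].
Proof.
rewrite /aw; case: ex_minnP => m /andP[m0 /asboolP mF] min; split=> [<-|].
  by split=> // s s0 sF; apply: min; rewrite s0; apply/asboolP.
case=> r0 rF rmin; apply/eqP; rewrite eqn_leq rmin // andbT.
by apply: min; rewrite r0; apply/asboolP.
Qed.

Lemma aw_no_rainbow (k : nat) :
  (forall (r : nat) (c : V -> 'I_r), ~ has_rainbow_ap k c) ->
  aw k = #|V|.+1.
Proof.
move=> noR; apply/awP; split=> // [c /exact_coloring_leq|s s0 sF].
  by rewrite ltnn.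
rewrite ltnNge; apply/negP => sV.
case: s => // s in s0 sF sV *.
pose c (x : V) : 'I_s.+1 := inord (enum_rank x).
apply: (noR _ c); apply: sF => a.
exists (enum_val (widen_ord sV a)).
by apply: ord_inj; rewrite /c enum_valK inordK /=.
Qed.

End Graphs.

Definition cart_prod (V W : finType) (e : rel V) (f : rel W) : rel (V * W) :=
  fun a b => (a.1 == b.1) && f a.2 b.2 || (a.2 == b.2) && e a.1 b.1.

(* Main.v *)
Require Import Defs.
From mathcomp Require Import all_boot.
From mathcomp Require Import boolp.
From mathcomp Require Import zify.

(** Write T and T' for the two trees and call T x {y} a row and {x} x T' a
    column of the product.

    Three colors do not suffice.  By the four-point condition, a tree that is
    not 3-peripheral has exactly two classes A, B of diametral vertices, with
    two vertices at distance diam exactly when one is in A and the other in B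
    ([tree_diametral_classes]).  Color A x A' red, B x B' blue and everything
    else white.  A red and a blue vertex are always at distance diam, and
    nothing but a blue (red) vertex is at that distance from a red (blue) one.
    So white cannot be at an end of a rainbow progression.  Nor can it be in
    the middle: the product is bipartite, so a vertex equidistant from the ends
    would make their distance, which is diam, even.

    Four colors suffice, for any two connected bipartite graphs in which every
    vertex has a neighbor ([four_values_not_rainbow_free]); only the metric
    matters, which is the sum of the metrics of the factors.  Suppose that
    there is no rainbow progression.
    - A row or a column has at most two colors ([row_two_valued]): a shortest
      geodesic with three colors reads red, white, ..., white, blue, and
      comparison with a parallel neighboring geodesic gives a contradiction.
    - Two rows, or two columns, have a color in common ([rows_share_value]),
      and a row always meets a column.  Pairwise meeting sets of at most two
      colors that cover four colors have a common element r ([common_value]).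
    - Two vertices of distinct colors other than r are at odd distance
      ([no_even_pair]).  But three vertices of the three other colors cannot be
      pairwise at odd distance in a bipartite graph.

    Everything about trees follows from two consequences of acyclicity: the
    ends of an edge are at different distances from any given vertex
    ([tree_no_level_edge]), and at most one neighbor of a vertex is closer to
    that given vertex ([tree_parent_unique]). *)

Set Implicit Arguments.
Unset Strict Implicit.
Unset Printing Implicit Defensive.

(** * Distances in a graph *)

Section Distance.
Variables (V : finType) (e : rel V).

Lemma dist_le_path x p : path e x p -> dist e x (last x p) <= size p.
Proof.
case/shortenP=> q eq uq sub.
have le_qp : size q <= size p.
  by apply: uniq_leq_size sub; case/andP: uq.
apply: leq_trans le_qp.
have lt_q : size q < #|V|.
  by have := max_card (mem (x :: q)); rewrite (card_uniqP uq).
rewrite /dist leqNgt; apply/negP=> /(before_find 0).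
rewrite nth_iota // add0n => /negbT/negP; apply; rewrite /has_path.
by apply/existsP; exists (in_tuple q); rewrite eq uq eqxx.
Qed.

Lemma dist_path x y : connect e x y ->
  exists p, [/\ path e x p, last x p = y & size p = dist e x y].
Proof.
case/connectP=> p0 /shortenP[p ep up _] yE.
have lt_p : size p < #|V|.
  by have := max_card (mem (x :: p)); rewrite (card_uniqP up).
have hp : has (has_path e x y) (iota 0 #|V|).
  apply/hasP; exists (size p); first by rewrite mem_iota.
  by rewrite /has_path; apply/existsP; exists (in_tuple p); rewrite ep up yE eqxx.
have := nth_find 0 hp; rewrite has_find size_iota in hp.
rewrite nth_iota // add0n => /existsP[q /and3P[eq /eqP lq _]].
by exists q; split; rewrite ?size_tuple.
Qed.

Lemma distxx x : dist e x x = 0.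
Proof. by have := @dist_le_path x [::] isT; rewrite leqn0 => /eqP. Qed.

(** A walk of length n changes f by at most n, and descending along f gives a
    walk of length f x y from x to y. *)
Lemma dist_unique (f : V -> V -> nat) :
    (forall x, f x x = 0) -> (forall x y, f x y = 0 -> x = y) ->
    (forall x y z, e x y -> f x z <= (f y z).+1) ->
    (forall x z, 0 < f x z -> exists2 y, e x y & f x z = (f y z).+1) ->
  forall x y, dist e x y = f x y.
Proof.
move=> f0 f_eq0 f_edge f_step.
have f_path x y : exists p, [/\ path e x p, last x p = y & size p = f x y].
  move En: (f x y) => n; elim: n x En => [|n IHn] x En.
    by exists [::]; split=> //=; apply: f_eq0.
  have [|x' exx' fx] := f_step x y; first by rewrite En.
  have [|p [ep <- <-]] := IHn x'; first by move: fx; rewrite En => -[].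
  by exists (x' :: p); rewrite /= exx'.
have f_le x p : path e x p -> f x (last x p) <= size p.
  elim: p x => [|x' p IHp] x /=; first by rewrite f0.
  by case/andP=> exx' ep; apply: leq_trans (f_edge _ _ _ exx') _; apply: IHp.
move=> x y; apply/eqP; rewrite eqn_leq.
have [p [ep lp sp]] := f_path x y.
have le_dist : dist e x y <= f x y by rewrite -sp -{1}lp dist_le_path.
have [|q [eq lq sq]] := @dist_path x y; first by apply/connectP; exists p.
by rewrite le_dist -sq -{1}lq f_le.
Qed.

Lemma dist_edge x y : e x y -> dist e x y <= 1.
Proof. by move=> exy; apply: (@dist_le_path x [:: y]); rewrite /= exy. Qed.

Lemma leq_dist_diam x y : dist e x y <= diam e.
Proof.
apply: leq_trans (leq_bigmax x) .
exact: (@leq_bigmax _ (fun y => dist e x y)).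
Qed.

Lemma diam_attained (x0 : V) : exists x y, dist e x y = diam e.
Proof.
have V0 : 0 < #|V| by apply/card_gt0P; exists x0.
have [x xE] := eq_bigmax (fun x => \max_y dist e x y) V0.
have [y yE] := eq_bigmax (dist e x) V0.
by exists x, y; rewrite /diam xE yE.
Qed.

Hypotheses (sym : symmetric e) (conn : connected_graph e).

Lemma dist_eq0 x y : dist e x y = 0 -> x = y.
Proof.
by have [p [_ lp <-]] := dist_path (conn x y); move/size0nil=> pE; rewrite -lp pE.
Qed.

Lemma dist_triangle y x z : dist e x z <= dist e x y + dist e y z.
Proof.
have [p [ep lp <-]] := dist_path (conn x y).
have [q [eq lq <-]] := dist_path (conn y z).
rewrite -size_cat -lq -lp -last_cat; apply: dist_le_path.
by rewrite cat_path ep lp.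
Qed.

Lemma dist_sym x y : dist e x y = dist e y x.
Proof.
suff le u v : dist e u v <= dist e v u by apply/eqP; rewrite eqn_leq !le.
have [p [ep <- <-]] := dist_path (conn v u).
elim: p v ep => [|w p IHp] v /=; first by rewrite distxx.
case/andP=> evw /IHp le_p; apply: leq_trans (dist_triangle w _ _) _.
by rewrite -addn1 leq_add // dist_edge // sym.
Qed.

Lemma dist_step x z : 0 < dist e x z ->
  exists2 y, e x y & dist e x z = (dist e y z).+1.
Proof.
have [[|y p] [/= ep lp sp]] := dist_path (conn x z); rewrite -sp // => _.
case/andP: ep => exy ep; exists y => //.
have := dist_le_path ep; have := dist_triangle y x z; have := dist_edge exy.
rewrite lp; lia.
Qed.
End Distance.

(** * Metrics of connected bipartite graphs *)

Definition geodesic (X : Type) (d : X -> X -> nat) (n : nat) (g : nat -> X) :=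
  forall i j, i <= j <= n -> d (g i) (g j) = j - i.

(** What the coloring argument uses of the distance of a connected bipartite
    graph.  Adjacency is distance 1. *)
Record bipartite_metric (X : Type) (d : X -> X -> nat) : Prop := {
  bm_refl : forall x, d x x = 0;
  bm_eq0 : forall x y, d x y = 0 -> x = y;
  bm_sym : forall x y, d x y = d y x;
  bm_triangle : forall y x z, d x z <= d x y + d y z;
  bm_parity : forall x y z, odd (d x z) = odd (d x y) (+) odd (d y z);
  bm_step : forall x z, 0 < d x z ->
    exists2 y, d x y = 1 & d x z = (d y z).+1
}.

Section Metric.
Variables (X : Type) (d : X -> X -> nat) (m : bipartite_metric d).

Lemma steps_geodesic n g :
    (forall i, i < n -> d (g i) (g i.+1) <= 1) -> d (g 0) (g n) = n ->
  geodesic d n g.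
Proof.
move=> step dn.
have le i k : i + k <= n -> d (g i) (g (i + k)) <= k.
  elim: k => [|k IHk] le_n; first by rewrite addn0 (bm_refl m).
  have := bm_triangle m (g (i + k)) (g i) (g (i + k).+1).
  by have := step (i + k); have := IHk; rewrite addnS; lia.
move=> i j /andP[le_ij le_jn].
have := le 0 i; have := le i (j - i); have := le j (n - j).
rewrite !subnKC // add0n.
have := bm_triangle m (g i) (g 0) (g n); have := bm_triangle m (g j) (g i) (g n).
lia.
Qed.

Lemma geodesicW n k g : k <= n -> geodesic d n g -> geodesic d k g.
Proof. by move=> le_kn gg i j ?; apply: gg; lia. Qed.

Lemma geodesic_ex x y :
  exists g, [/\ g 0 = x, g (d x y) = y & geodesic d (d x y) g].
Proof.
suff [g [g0 gn gs]] : exists g, [/\ g 0 = x, g (d x y) = y &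
    forall i, i < d x y -> d (g i) (g i.+1) <= 1].
  by exists g; split=> //; apply: steps_geodesic => //; rewrite g0 gn.
move En: (d x y) => n; elim: n x En => [|n IHn] x En.
  by exists (fun=> x); split=> //; apply: (bm_eq0 m).
have [|x' dx' dy] := bm_step m (x := x) (z := y); first by rewrite En.
have [|g [g0 gn gs]] := IHn x'; first by lia.
exists (fun i => if i is j.+1 then g j else x); split=> // -[_|i /gs //].
by rewrite g0 dx'.
Qed.

Lemma geodesic_step n g i : geodesic d n g -> i < n -> d (g i) (g i.+1) = 1.
Proof. by move=> gg lt_in; rewrite gg; lia. Qed.

Lemma change_on_edge (C : eqType) (f : X -> C) x y : f x <> f y ->
  exists u v, d u v = 1 /\ f u <> f v.
Proof.
have [g [g0 gn gg]] := geodesic_ex x y; rewrite -{1}g0 -{1}gn.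
elim: (d x y) gg => [|n IHn] gg; first by case.
have [En|/eqP nEn] := eqVneq (f (g n)) (f (g n.+1)).
  by rewrite -En; apply/IHn/(geodesicW _ gg).
by exists (g n), (g n.+1); split=> //; apply: geodesic_step gg _.
Qed.

Lemma parity_edge x y z : d x y = 1 ->
  d z y = (d z x).+1 \/ d z x = (d z y).+1.
Proof.
move=> dxy; have := bm_parity m z x y; have := bm_triangle m x z y.
have := bm_triangle m y z x; rewrite (bm_sym m y x) dxy; lia.
Qed.
End Metric.

(** * Colorings of a product without rainbow progressions *)

Definition two_valued (X C : Type) (f : X -> C) :=
  exists a b, forall x, f x = a \/ f x = b.

Definition not_rainbow (C : Type) (a b c : C) := a = b \/ b = c \/ a = c.

(** The color of (x, y) is c x y, so that exchanging the two factors is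
    exchanging the arguments. *)
Definition rainbow_free (X Y C : Type) (dX : X -> X -> nat) (dY : Y -> Y -> nat)
    (c : X -> Y -> C) :=
  forall x1 y1 x2 y2 x3 y3, dX x1 x2 + dY y1 y2 = dX x2 x3 + dY y2 y3 ->
  not_rainbow (c x1 y1) (c x2 y2) (c x3 y3).

(** That no three values suffice, the form in which having at least four
    colors is used. *)
Definition four_values (X Y C : Type) (c : X -> Y -> C) :=
  forall a1 a2 a3, exists x y, [/\ c x y <> a1, c x y <> a2 & c x y <> a3].

Lemma rainbow_free_transpose (X Y C : Type) (dX : X -> X -> nat)
    (dY : Y -> Y -> nat) (c : X -> Y -> C) :
  rainbow_free dX dY c -> rainbow_free dY dX (fun y x => c x y).
Proof. by move=> rf y1 x1 y2 x2 y3 x3 eqd; apply: rf; lia. Qed.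

Lemma four_values_transpose (X Y C : Type) (c : X -> Y -> C) :
  four_values c -> four_values (fun y x => c x y).
Proof. by move=> c4 a1 a2 a3; have [x [y ?]] := c4 a1 a2 a3; exists y, x. Qed.

Lemma two_valued_fill (X : Type) (C : eqType) (f : X -> C) x y z : two_valued f ->
  f x <> f y -> f z = f x \/ f z = f y.
Proof.
by case=> a [b ab]; case: (ab x) (ab y) (ab z) => -> [] -> [] -> ?; tauto.
Qed.

Section Rows.
Variables (X Y : Type) (C : eqType) (dX : X -> X -> nat) (dY : Y -> Y -> nat).
Variables (mX : bipartite_metric dX) (mY : bipartite_metric dY).
Variable c : X -> Y -> C.
Hypothesis rf : rainbow_free dX dY c.

(** Let n be minimal such that a geodesic p_0 ... p_n in some row has three
    colors.  Then p_0 is red, p_n is blue and all inner vertices are white.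
    Let q_i be the vertices above p_i in an adjacent row.  The progressions
    (q_1, p_n, p_0), of difference n, and (q_1, p_1, p_0) make q_1 red;
    likewise q_(n-1) is blue.  But red propagates from q_i to q_(i+1): that
    color is red or white because of (p_(i+1), q_(i+1), q_i), and red or blue
    by the minimality of n. *)
Lemma geodesic_not_rainbow (nbrY : forall y, exists y', dY y y' = 1)
    n g y i j k :
    geodesic dX n g -> i <= j -> j <= k -> k <= n ->
  not_rainbow (c (g i) y) (c (g j) y) (c (g k) y).
Proof.
elim/ltn_ind: n g y i j k => n IHn g y i j k gg le_ij le_jk le_kn.
have [lt_n|ge_n] := ltnP (k - i) n.
  have := IHn _ lt_n (fun l => g (i + l)) y 0 (j - i) (k - i).
  rewrite !addn0 !subnKC ?(leq_trans le_ij) //; apply; try lia.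
  by move=> ? ? ?; rewrite gg; lia.
have {ge_n} [i0 kn] : i = 0 /\ k = n by lia.
rewrite {i}i0 {k}kn in le_ij le_jk le_kn *.
have [->|/eqP nab] := eqVneq (c (g 0) y) (c (g j) y); first by left.
have [->|/eqP nbc] := eqVneq (c (g j) y) (c (g n) y); first by right; left.
have [->|/eqP nac] := eqVneq (c (g 0) y) (c (g n) y); first by right; right.
exfalso.
have [j0 jn] : 0 < j /\ j < n.
  have : j <> 0 by move=> j0; apply: nab; rewrite j0.
  have : j <> n by move=> jn; apply: nbc; rewrite jn.
  by lia.
have sub y1 i1 j1 k1 : i1 <= j1 -> j1 <= k1 -> k1 <= n -> k1 - i1 < n ->
    not_rainbow (c (g i1) y1) (c (g j1) y1) (c (g k1) y1).
  move=> le1 le2 le3 lt_n.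
  have := IHn _ lt_n (fun l => g (i1 + l)) y1 0 (j1 - i1) (k1 - i1).
  rewrite !addn0 !subnKC ?(leq_trans le1) //; apply; try lia.
  by move=> ? ? ?; rewrite gg; lia.
have dg u v : u <= v <= n -> dX (g u) (g v) = v - u /\ dX (g v) (g u) = v - u.
  by move=> uv; rewrite (bm_sym mX (g v)) gg.
(* An inner vertex lies, together with the one at j, in a proper initial and
   in a proper final segment; neither segment has three colors. *)
have inner i : 0 < i -> i < n -> c (g i) y = c (g j) y.
  move=> i0 lt_in.
  have : not_rainbow (c (g 0) y) (c (g i) y) (c (g j) y) /\
         not_rainbow (c (g i) y) (c (g j) y) (c (g n) y) \/
         not_rainbow (c (g 0) y) (c (g j) y) (c (g i) y) /\
         not_rainbow (c (g j) y) (c (g i) y) (c (g n) y).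
    by case/orP: (leq_total i j) => le; [left | right]; split; apply: sub; lia.
  by rewrite /not_rainbow; intuition congruence.
have [y' dyy'] := nbrY y.
have dy'y : dY y' y = 1 by rewrite (bm_sym mY).
have dyy : dY y y = 0 by exact: (bm_refl mY).
have dXX x : dX x x = 0 by exact: (bm_refl mX).
have q1 : c (g 1) y' = c (g 0) y.
  have := @rf (g 1) y' (g n) y (g 0) y; have := @rf (g 1) y' (g 1) y (g 0) y.
  rewrite (inner 1) //; last by lia.
  have [? ?] := dg 1 n ltac:(lia); have [? ?] := dg 0 n ltac:(lia).
  have [? ?] := dg 0 1 ltac:(lia).
  rewrite dXX dy'y dyy => /(_ ltac:(lia)) A /(_ ltac:(lia)).
  by move: A; rewrite /not_rainbow; intuition congruence.
have qn : c (g n.-1) y' = c (g n) y.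
  have := @rf (g n.-1) y' (g 0) y (g n) y.
  have := @rf (g n.-1) y' (g n.-1) y (g n) y.
  rewrite (inner n.-1) //; [|by lia..].
  have [? ?] := dg n.-1 n ltac:(lia); have [? ?] := dg 0 n ltac:(lia).
  have [? ?] := dg 0 n.-1 ltac:(lia).
  rewrite dXX dy'y dyy => /(_ ltac:(lia)) A /(_ ltac:(lia)).
  by move: A; rewrite /not_rainbow; intuition congruence.
have qi i : i.+1 < n -> c (g i.+1) y' = c (g 0) y.
  elim: i => [//|i IHi] lt_i.
  have := @rf (g i.+1) y' (g i.+2) y' (g i.+2) y.
  have := sub y' 1 i.+2 n.-1.
  rewrite (inner i.+2) // q1 qn IHi; last by lia.
  have [? ?] := dg i.+1 i.+2 ltac:(lia).
  rewrite dXX dy'y (bm_refl mY) => A /(_ ltac:(lia)).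
  have {}A := A ltac:(lia) ltac:(lia) ltac:(lia) ltac:(lia).
  by move: A; rewrite /not_rainbow; intuition congruence.
by apply: nac; rewrite -(qi n.-2) -?qn; [congr (c (g _) _)|]; lia.
Qed.

(** Given an edge uv with two colors, a vertex z with a third color would be
    on a geodesic with both ends of the edge, as u and v are not at the same
    distance from z. *)
Lemma row_two_valued (x0 : X) : (forall y, exists y', dY y y' = 1) ->
  forall y, two_valued (fun x => c x y).
Proof.
move=> nbrY y.
have geo x1 x2 x3 : dX x1 x3 = dX x1 x2 + dX x2 x3 -> dX x2 x3 = 1 ->
    not_rainbow (c x1 y) (c x2 y) (c x3 y).
  move=> dx dx1; have [g [g0 gn gg]] := geodesic_ex mX x1 x2.
  pose h i := if i <= dX x1 x2 then g i else x3.
  have h0 : h 0 = x1 by rewrite /h leq0n.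
  have h2 : h (dX x1 x2) = x2 by rewrite /h leqnn.
  have h3 : h (dX x1 x3) = x3 by rewrite /h leqNgt dx dx1 addn1 ltnSn.
  have hh : geodesic dX (dX x1 x3) h.
    apply: (steps_geodesic mX); last by rewrite h0 h3.
    move=> i; rewrite dx dx1 addn1 ltnS /h => le_i; rewrite le_i.
    have [lt_i|ge_i] := ltnP; first by rewrite (geodesic_step gg).
    have -> : i = dX x1 x2 by lia.
    by rewrite gn dx1.
  have := @geodesic_not_rainbow nbrY _ h y 0 (dX x1 x2) (dX x1 x3) hh.
  rewrite h0 h2 h3.
  by apply; lia.
have [const|/existsNP[x1 nx1]] := pselect (forall x, c x y = c x0 y).
  by exists (c x0 y), (c x0 y); left.
have [u [v [duv nuv]]] := change_on_edge mX (f := fun x => c x y) nx1.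
exists (c u y), (c v y) => z.
have duv' : dX v u = 1 by rewrite (bm_sym mX).
have := parity_edge mX z duv.
case=> dz; [have := @geo z u v | have := @geo z v u]; rewrite dz ?duv ?duv' addn1.
  by move=> /(_ erefl erefl) []; intuition congruence.
by move=> /(_ erefl erefl) []; intuition congruence.
Qed.

(** Suppose that the rows y and y' have disjoint color sets.  Then the colors
    of each column are its color in row y and its color in row y', and by the
    four colors row y is not monochromatic.  Row y now propagates unchanged
    along a geodesic to y', which is absurd.  For the next row keeps the colors
    above a bichromatic edge uv, since the paths of length 2 through u and v
    allow no color of row y' there; if it differed from row y elsewhere, it
    would have a third color. *)
Lemma rows_share_value (x0 : X) (c4 : four_values c) :
    (forall y, two_valued (fun x => c x y)) -> (forall x, two_valued (c x)) ->
  forall y y', exists x x', c x y = c x' y'.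
Proof.
move=> rows cols y y'.
have [//|disj] := pselect (exists x x', c x y = c x' y'); exfalso.
have nP x x' : c x y <> c x' y' by move=> E; apply: disj; exists x, x'.
have col x z : c x z = c x y \/ c x z = c x y'.
  exact: two_valued_fill (cols x) (nP x x).
have [a [b ab]] := rows y; have [a' [b' ab']] := rows y'.
have off k : exists x, c x y <> k.
  have [x [z [n1 n2 n3]]] := c4 k a' b'; exists x => E.
  by case: (col x z) => Ez; [|case: (ab' x)] => *; congruence.
have [x1 nx1] := off (c x0 y).
have [u [v [duv nuv]]] := change_on_edge mX (f := fun x => c x y) nx1.
have [g [g0 gn gg]] := geodesic_ex mY y y'.
suff same i : i <= dY y y' -> forall x, c x (g i) = c x y.
  by apply: (nP x0 x0); rewrite -(same _ (leqnn _)) gn.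
elim: i => [|i IHi] lt_i x; first by rewrite g0.
have row_i := IHi (ltnW lt_i).
have dg : dY (g i.+1) (g i) = 1 by rewrite (bm_sym mY) (geodesic_step gg).
have keep u1 v1 : dX u1 v1 = 1 -> c u1 y <> c v1 y -> c u1 (g i.+1) = c u1 y.
  move=> d1 n1; have := @rf u1 (g i.+1) u1 (g i) v1 (g i).
  rewrite d1 dg !(bm_refl mX, bm_refl mY) !row_i => /(_ erefl).
  have := nP u1 u1; have := nP v1 u1.
  by case: (col u1 (g i.+1)) => // ->; rewrite /not_rainbow; intuition congruence.
have ku := keep u v duv nuv.
have kv : c v (g i.+1) = c v y
  by apply: (keep v u); rewrite 1?(bm_sym mX) //; exact/nesym.
case: (col x (g i.+1)) => // E.
have /(two_valued_fill (x := u) (y := v) x) := rows (g i.+1).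
by rewrite ku kv E => /(_ nuv) []/esym/nP.
Qed.
End Rows.

(** Pairwise meeting sets of at most two values have a common element, unless
    they include the three sides of a triangle; and then they cover only three
    values. *)
Lemma common_value (I C : Type) (A : I -> C -> Prop) :
    (forall i, exists a b, forall t, A i t -> t = a \/ t = b) ->
    (forall i j, exists t, A i t /\ A j t) ->
    (forall a1 a2 a3, exists i t, [/\ A i t, t <> a1, t <> a2 & t <> a3]) ->
    I ->
  exists r, forall i, A i r.
Proof.
move=> two meet cover i0.
have three i a b t : A i a -> A i b -> A i t -> a <> b -> t = a \/ t = b.
  by have [k [l kl]] := two i; move=> /kl + /kl + /kl; intuition congruence.
have [k [l kl]] := two i0.
have [i1 [p [i1p np1 np2 _]]] := cover k l l.
have [a [i0a i1a]] := meet i0 i1.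
have [b i0b] : exists b, forall t, A i0 t -> t = a \/ t = b.
  by case: (kl _ i0a) => ->; [exists l|exists k] => t /kl; tauto.
have nip t : A i0 t -> p <> t by move=> /kl[] ->.
have [i2 [h [i2h nha nhb nhp]]] := cover a b p.
(* Without a, t = b and s = p, so that A i would contain b, p and h. *)
have no_triple i t s : A i t -> A i s -> A i0 t -> A i1 s -> A i h -> A i a.
  move=> it is_ i0t i1s ih.
  case: (i0b _ i0t) => E; first by rewrite -E.
  case: (three _ _ _ _ i1p i1a i1s (nip _ i0a)) => F; last by rewrite -F.
  have nps := nip _ i0t; subst t s.
  by case: (three _ _ _ _ ih it is_ nhb) => G; congruence.
have i2a : A i2 a.
  have [t [i0t i2t]] := meet i0 i2; have [s [i1s i2s]] := meet i1 i2.
  exact: (no_triple _ t s).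
(* As A i2 is contained in {a, h}, a set A i without a contains h. *)
exists a => i.
have [t [i0t it]] := meet i0 i; have [s [i1s is_]] := meet i1 i.
have [r [i2r ir]] := meet i2 i.
case: (three _ _ _ _ i2h i2a i2r nha) => E; rewrite E in ir => //.
exact: (no_triple _ t s).
Qed.

(** Suppose that (x, y) of color b and (x', y') of color g are at distance 2k, and
    let v and w be the vertices at distance k from y and from y', respectively, on
    a geodesic from y to y'; here dX x x' <= dY y y' ensures that they exist.
    Both (x, v) and (x', w) are midpoints, so they are colored b or g, hence b
    and g by their columns.  As dY v w = dX x x', the vertex (x, w) is
    equidistant from these two, so it has color b or g, hence b by its column;
    but then the row of w contains b, g and r. *)
Lemma no_even_pair (X Y : Type) (C : eqType) (dX : X -> X -> nat)
    (dY : Y -> Y -> nat) (mX : bipartite_metric dX) (mY : bipartite_metric dY)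
    (c : X -> Y -> C) (r : C) (x x' : X) (y y' : Y) :
    rainbow_free dX dY c ->
    (forall y, two_valued (fun x => c x y)) -> (forall x, two_valued (c x)) ->
    (forall y, exists x, c x y = r) -> (forall x, exists y, c x y = r) ->
    c x y <> r -> c x' y' <> r -> c x y <> c x' y' ->
    dX x x' <= dY y y' ->
  odd (dX x x' + dY y y').
Proof.
move=> rf rows cols rowr colr nr nr' ncc le_d; apply/negPn/negP => ev.
have col u v w : c u v <> r -> c u w = r \/ c u w = c u v.
  move=> n; have [z zr] := colr u; rewrite -zr.
  by apply: (two_valued_fill w (cols u)); rewrite zr; exact/nesym.
have row u v w : c u v <> r -> c w v = r \/ c w v = c u v.
  move=> n; have [z zr] := rowr v; rewrite -zr.
  by apply: (two_valued_fill w (rows v)); rewrite zr; exact/nesym.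
have [g [g0 gn gg]] := geodesic_ex mY y y'.
set s := dX x x' in ev le_d *; set t := dY y y' in ev le_d g0 gn gg *.
(* In the notation above, v = g k and w = g (t - k). *)
pose k := (s + t)./2.
have kE : s + t = k + k by rewrite /k; lia.
have dg i j : i <= j <= t -> dY (g i) (g j) = j - i /\ dY (g j) (g i) = j - i.
  by move=> ij; rewrite (bm_sym mY (g j)) gg.
have dxx u : dX u u = 0 by exact: (bm_refl mX).
have cm : c x (g k) = c x y.
  have [? ?] := dg 0 k ltac:(lia); have [? ?] := dg k t ltac:(lia).
  have := rf x (g 0) x (g k) x' (g t); rewrite dxx => /(_ ltac:(lia)).
  rewrite g0 gn; have := col x y (g k) nr.
  by rewrite /not_rainbow; intuition congruence.
have cm' : c x' (g (t - k)) = c x' y'.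
  have [? ?] := dg 0 (t - k) ltac:(lia); have [? ?] := dg (t - k) t ltac:(lia).
  have := rf x (g 0) x' (g (t - k)) x' (g t); rewrite dxx => /(_ ltac:(lia)).
  rewrite g0 gn; have := col x' y' (g (t - k)) nr'.
  by rewrite /not_rainbow; intuition congruence.
have := rf x (g k) x (g (t - k)) x' (g (t - k)).
have [? ?] := dg (t - k) k ltac:(lia); have [? ?] := dg (t - k) (t - k) ltac:(lia).
rewrite dxx => /(_ ltac:(lia)); rewrite cm cm'.
have := col x y (g (t - k)) nr.
have := row x' (g (t - k)) x; rewrite cm' => /(_ nr').
by rewrite /not_rainbow; intuition congruence.
Qed.

Theorem four_values_not_rainbow_free (X Y : Type) (C : eqType) (dX : X -> X -> nat)
    (dY : Y -> Y -> nat) (mX : bipartite_metric dX) (mY : bipartite_metric dY)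
    (nbrX : forall x, exists x', dX x x' = 1)
    (nbrY : forall y, exists y', dY y y' = 1) (c : X -> Y -> C) (x0 : X) (y0 : Y) :
  four_values c -> ~ rainbow_free dX dY c.
Proof.
move=> c4 rf; have rfT := rainbow_free_transpose rf.
have c4T := four_values_transpose c4.
have rows := row_two_valued mX mY rf x0 nbrY.
have cols := row_two_valued mY mX rfT y0 nbrX.
have rows_meet := rows_share_value mX mY rf x0 c4 rows cols.
have cols_meet := rows_share_value mY mX rfT y0 c4T cols rows.
have [||||r rA] := @common_value (X + Y) C
  (fun i t => match i with
              | inl x => exists y, c x y = t
              | inr y => exists x, c x y = t
              end).
- case=> [x|y]; [have [a [b ab]] := cols x|have [a [b ab]] := rows y];
    by exists a, b => _ [? <-].
- case=> [x|y] [x'|y'].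
  + by have [y [y' E]] := cols_meet x x'; exists (c x y); split; [exists y|exists y'].
  + by exists (c x y'); split; [exists y'|exists x].
  + by exists (c x' y); split; [exists x'|exists y].
  + by have [x [x' E]] := rows_meet y y'; exists (c x y); split; [exists x|exists x'].
- move=> a1 a2 a3; have [x [y [? ? ?]]] := c4 a1 a2 a3.
  by exists (inl x), (c x y); split=> //; exists y.
- exact: inl x0.
have colr x : exists y, c x y = r by exact: (rA (inl x)).
have rowr y : exists x, c x y = r by exact: (rA (inr y)).
have odd_pair x y x' y' : c x y <> r -> c x' y' <> r -> c x y <> c x' y' ->
    odd (dX x x' + dY y y').
  move=> nr nr' ncc; have [le|/ltnW ge] := leqP (dX x x') (dY y y').
    exact: (no_even_pair mX mY rf rows cols rowr colr).
  by rewrite addnC; apply: (no_even_pair mY mX rfT cols rows colr rowr).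
have [x1 [y1 [n1 _ _]]] := c4 r r r.
have [x2 [y2 [n2 n12 _]]] := c4 r (c x1 y1) r.
have [x3 [y3 [n3 n13 n23]]] := c4 r (c x1 y1) (c x2 y2).
have := odd_pair _ _ _ _ n1 n2 (nesym n12).
have := odd_pair _ _ _ _ n2 n3 (nesym n23).
have := odd_pair _ _ _ _ n1 n3 (nesym n13).
rewrite !oddD (bm_parity mX x1 x2 x3) (bm_parity mY y1 y2 y3).
by case: (odd _) (odd _) (odd _) (odd _) => [] [] [] [].
Qed.

(** * Distances in trees *)

Section Tree.
Variables (V : finType) (e : rel V).
Hypothesis treeT : tree e.

Let sym : symmetric e. Proof. by case: treeT => -[]. Qed.
Let conn : connected_graph e. Proof. by case: treeT. Qed.
Let d := dist e.

(** Each vertex of the ball of radius k around z is joined to z by a geodesic,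
    which stays in the ball. *)
Lemma ball_path k z a b : d a z <= k -> d b z <= k ->
  exists p, [/\ path e a p, last a p = b, uniq (a :: p) &
                all (fun v => d v z <= k) (a :: p)].
Proof.
pose e' := [rel u v | [&& e u v, d u z <= k & d v z <= k]].
have toz u : d u z <= k -> connect e' u z.
  move En: (d u z) => n; elim: n u En => [|n IHn] u En le_k.
    by rewrite (dist_eq0 conn En) connect0.
  have [|v euv] := @dist_step _ _ conn u z; first by rewrite -/d En.
  rewrite -!/(d _ _) En => -[dv]; apply: connect_trans (IHn v _ _); rewrite ?dv //.
    by apply: connect1; rewrite /= euv En -dv; lia.
  by lia.
have sym' : connect_sym e'.
  by apply: sym_connect_sym => u v /=; rewrite sym [_ && (d v z <= k)]andbC.
move=> ak bk; have /connectP[p0 /shortenP[p ep up _] ->] : connect e' a b.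
  by apply: connect_trans (toz a ak) _; rewrite sym' toz.
exists p; split=> //; first by apply: sub_path ep => u v /= /andP[].
rewrite /= ak; elim: p a ep {ak up} => //= v p IHp a /andP[/and3P[_ _ ->]].
exact: IHp.
Qed.

(** Otherwise the ends x, y of the edge, neighbors x', y' of theirs that are
    closer to z, and a path from y' to x' in the ball containing these form a
    cycle. *)
Lemma tree_no_level_edge x y z : e x y -> d x z != d y z.
Proof.
have [_ _ acyc] := treeT; have irr : irreflexive e by case: treeT => -[].
move=> exy; apply/eqP => dE.
have nxy : x != y by apply: contraTneq exy => ->; rewrite irr.
have d0 : 0 < d x z.
  rewrite lt0n; apply: contraNneq nxy => d0.
  have yz : y = z by apply: (dist_eq0 conn); rewrite -/d -dE.
  by rewrite yz; apply/eqP; apply: (dist_eq0 conn).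
have [x' exx' dx] := dist_step conn d0.
have [|y' eyy' dy] := @dist_step _ _ conn y z; first by rewrite -/d -dE.
move: dx dy; rewrite -!/(d _ _) => dx dy.
have [||p [ep lp up /allP ball]] := @ball_path (d x' z) z y' x' => //; first lia.
have far u : d x z <= d u z -> u \notin y' :: p.
  by move=> le; apply/negP => /ball; lia.
suff /acyc : ucycle e [:: x, y, y' & p] by [].
rewrite /ucycle /= rcons_path exy eyy' ep lp sym exx' /=.
by rewrite inE (negbTE nxy) !far ?dE.
Qed.

(** Two such neighbors are joined by a path in a ball around z that does not
    contain x, so x closes a cycle. *)
Lemma tree_parent_unique x a b z : e x a -> e x b ->
  d x z = (d a z).+1 -> d x z = (d b z).+1 -> a = b.
Proof.
have [_ _ acyc] := treeT; move=> exa exb da db.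
apply/eqP/negPn/negP => nab.
have [||[|v p] [ep lp up /allP ball]] := @ball_path (d a z) z a b => //; first lia.
  by move: nab; rewrite -lp eqxx.
suff /acyc : ucycle e [:: x, a, v & p] by [].
rewrite /ucycle (cons_uniq x) up andbT; apply/andP; split.
  by move: ep lp => /= /andP[eav ep] lp; rewrite rcons_path exa eav ep lp sym.
by apply/negP => /ball; lia.
Qed.

Lemma dist_edge_leS x y z : e x y -> d x z <= (d y z).+1.
Proof.
move=> exy; have := dist_triangle conn y x z; have := dist_edge exy.
by rewrite -/d; lia.
Qed.

Lemma tree_bipartite_metric : bipartite_metric d.
Proof.
have edge1 x y : e x y -> d x y = 1.
  move=> exy; have := dist_edge exy; have := tree_no_level_edge y exy.
  by rewrite -/d {2}/d distxx; lia.
split.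
- exact: distxx.
- exact: dist_eq0.
- exact: dist_sym.
- exact: dist_triangle.
- move=> x y z; move En: (d x y) => n; elim: n x En => [|n IHn] x En.
    by rewrite (dist_eq0 conn En).
  have [|x' exx'] := @dist_step _ _ conn x y; first by rewrite -/d En.
  rewrite -!/(d _ _) En => -[dx]; have := IHn x' (esym dx).
  have := dist_edge_leS z exx'; have := @dist_edge_leS x' x z; rewrite sym => /(_ exx').
  by have := tree_no_level_edge z exx'; lia.
- move=> x z /(dist_step conn)[y exy dE].
  by exists y => //; apply: edge1.
Qed.

(** Going from x to z, the first step leads away from y because the neighbor of
    x closer to y is n; then so does every further step, as the only neighbor
    closer to y is the vertex one comes from.  Hence the induction on d x z,
    replacing x by m and n by x. *)
Lemma tree_between x y z n m : e x n -> e x m -> n <> m ->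
  d x y = (d n y).+1 -> d x z = (d m z).+1 -> d y z = d x y + d x z.
Proof.
have bm := tree_bipartite_metric.
move=> exn exm nm dn dm.
move El: (d x z) => l; rewrite El in dm.
elim: l x n m exn exm nm dn dm El => // l IHl x n m exn exm nm dn [lE] El.
have dmy : d m y = (d x y).+1.
  have := dist_edge_leS y exm; have := @dist_edge_leS m x y; rewrite sym => /(_ exm).
  have := tree_no_level_edge y exm => ne le1 le2.
  suff : d x y <> (d m y).+1 by lia.
  by move=> dm; apply: nm; apply: tree_parent_unique exn exm dn dm.
have [l0|l_gt0] := posnP l.
  have -> : z = m by apply/esym/(dist_eq0 conn); rewrite -/d -lE l0.
  by rewrite (bm_sym bm) dmy l0 addn1.
have [|m' emm'] := @dist_step _ _ conn m z; first by rewrite -/d -lE.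
rewrite -!/(d _ _) => dm'.
rewrite (IHl m x m') // 1?sym -?lE ?dmy ?addSnnS //.
  by move=> xm'; move: dm'; rewrite -xm'; lia.
by rewrite dm' in lE.
Qed.

(** Induction on the distances from x.  If the neighbors of x towards y, z and w
    coincide, replacing x by this neighbor lowers each sum by 1.  Otherwise at
    least two pairs among y, z, w are separated by x, which determines two of
    the distances.  The induction needs the three permutations of the
    inequality together. *)
Lemma tree_four_point x y z w : d x y + d z w <= maxn (d x z + d y w) (d x w + d y z).
Proof.
have bm := tree_bipartite_metric.
have ds := bm_sym bm; have dt := bm_triangle bm; have d0 := bm_refl bm.
suff [] : [/\ d x y + d z w <= maxn (d x z + d y w) (d x w + d y z),
   d x z + d y w <= maxn (d x y + d z w) (d x w + d y z) &
   d x w + d y z <= maxn (d x y + d z w) (d x z + d y w)] by [].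
move En: (d x y + d x z + d x w) => n; elim/ltn_ind: n x En => n IHn x En.
have [/(bm_eq0 bm)<-|y0] := posnP (d x y).
  rewrite !d0; have := dt x z w; rewrite (ds z x); split; lia.
have [/(bm_eq0 bm)<-|z0] := posnP (d x z).
  rewrite !d0 (ds y x); have := dt x y w; rewrite (ds y x); split; lia.
have [/(bm_eq0 bm)<-|w0] := posnP (d x w).
  rewrite !d0 (ds y x) (ds z x); have := dt x y z; rewrite (ds y x); split; lia.
have [a exa da] := dist_step conn y0.
have [b exb db] := dist_step conn z0.
have [c exc dc] := dist_step conn w0.
have tyz := dt x y z; have tyw := dt x y w; have tzw := dt x z w.
rewrite (ds y x) in tyz tyw; rewrite (ds z x) in tzw.
have [ab|/eqP ab] := eqVneq a b; have [ac|/eqP ac] := eqVneq a c.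
- subst b c; move: da db dc; rewrite -!/(d _ _) => da db dc.
  have [|I1 I2 I3] := IHn (d a y + d a z + d a w) _ a erefl; first by lia.
  by split; lia.
- have bc : b <> c by rewrite -ab.
  have := tree_between exa exc ac da dc; have := tree_between exb exc bc db dc.
  by split; lia.
- have cb : c <> b by rewrite -ac.
  have := tree_between exa exb ab da db; have := tree_between exc exb cb dc db.
  by rewrite (ds w z); split; lia.
- have := tree_between exa exb ab da db; have := tree_between exa exc ac da dc.
  by split; lia.
Qed.

(** Take x, y at distance diam e, and let A and B be the sets of the vertices at
    that distance from y and from x.  If a is in A, it is not at distance
    diam e from x, as x, y, a would make the tree 3-peripheral; so the
    four-point condition for x, y, a, w says that w is at distance diam e from
    a exactly when it is at that distance from x. *)
Lemma tree_diametral_classes : ~ peripheral e 3 -> 1 < #|V| ->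
  exists A B : {set V},
    [/\ exists2 a, a \in A & a \notin B, exists b, b \in B,
        forall a, a \in A -> forall w, (w \in B) = (d a w == diam e) &
        forall b, b \in B -> forall w, (w \in A) = (d b w == diam e)].
Proof.
move=> not3 V2; have bm := tree_bipartite_metric.
have ds := bm_sym bm; have d0 := bm_refl bm.
have [u [v [_ _ nuv]]] : exists u v, [/\ u \in V, v \in V & u != v].
  by have /card_gt1P := V2.
have D0 : 0 < diam e.
  apply: leq_trans (leq_dist_diam e u v); rewrite lt0n.
  by apply: contra_neq nuv => /(dist_eq0 conn).
have dD a b : d a b <= diam e by exact: leq_dist_diam.
have no3 a b c : d a b = diam e -> d b c = diam e -> d a c = diam e -> False.
  move=> ab bc ac; apply: not3; exists (fun i : 'I_3 => nth a [:: a; b; c] i).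
  have dist3 (i j : 'I_3) : i != j ->
      dist e (nth a [:: a; b; c] i) (nth a [:: a; b; c] j) = diam e.
    case: i j => [[|[|[|//]]] ?] [[|[|[|//]]] ?] //= _; rewrite -/d //.
    - by rewrite ds.
    - by rewrite ds.
    - by rewrite ds.
  split=> // i j E; apply/eqP/negPn/negP => /dist3; rewrite E -/d d0.
  by move=> D; rewrite -D in D0.
have [x [y xy]] := diam_attained e u; rewrite -/d in xy.
exists [set a | d a y == diam e], [set b | d x b == diam e].
split.
- by exists x; rewrite inE ?xy // d0 neq_ltn D0.
- by exists y; rewrite inE xy.
- move=> a; rewrite inE => /eqP ay w; rewrite inE.
  have nax : d x a <> diam e by move=> xa; apply: (no3 x a y).
  have := tree_four_point x y a w; have := tree_four_point x w a y.
  have := dD x a; have := dD y w; have := dD x w; have := dD a w.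
  by have := ds y a; have := ds w y; have := ds w a; lia.
- move=> b; rewrite inE => /eqP xb w; rewrite inE.
  have nby : d b y <> diam e by move=> yb; apply: (no3 x b y).
  have := tree_four_point x y b w; have := tree_four_point x b w y.
  have := dD b y; have := dD y w; have := dD x w; have := dD b w.
  by have := ds y b; have := ds w y; have := ds w b; lia.
Qed.

Lemma tree_neighbor : 1 < #|V| -> forall x, exists y, d x y = 1.
Proof.
move=> V2 x; have bm := tree_bipartite_metric.
have [y nyx] : exists y, x != y.
  have /card_gt1P[u [v [_ _ nuv]]] := V2.
  by have [xu|] := eqVneq x u; [exists v; rewrite xu | exists u].
have [|z xz _] := @bm_step _ _ bm x y; last by exists z.
by rewrite lt0n; apply: contra_neq nyx => /(bm_eq0 bm).
Qed.
End Tree.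

(** * Products *)

Section Product.
Variables (V W : finType) (e : rel V) (f : rel W).
Hypotheses (connV : connected_graph e) (connW : connected_graph f).

Lemma dist_cart_prod p q :
  dist (cart_prod e f) p q = dist e p.1 q.1 + dist f p.2 q.2.
Proof.
apply: (dist_unique (f := fun p q => dist e p.1 q.1 + dist f p.2 q.2)) => {p q}.
- by move=> p; rewrite !distxx.
- move=> [x y] [x' y'] /= /eqP; rewrite addn_eq0 => /andP[/eqP d1 /eqP d2].
  by rewrite (dist_eq0 connV d1) (dist_eq0 connW d2).
- move=> [x y] [x' y'] [x'' y'']; rewrite /cart_prod /=.
  have tV := dist_triangle connV x' x x''; have tW := dist_triangle connW y' y y''.
  case/orP=> /andP[/eqP-> /dist_edge le1]; lia.
- move=> [x y] [x'' y''] /=; have [d0|d0] := posnP (dist e x x'').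
    rewrite d0 => /(dist_step connW)[y' eyy' ->].
    by exists (x, y'); rewrite /cart_prod /= ?eyy' ?eqxx // d0.
  have [x' exx' ->] := dist_step connV d0.
  by exists (x', y); rewrite /cart_prod /= ?exx' ?eqxx ?orbT.
Qed.

Lemma diam_cart_prod (x : V) (y : W) :
  diam (cart_prod e f) = diam e + diam f.
Proof.
have [p [q pq]] := diam_attained (cart_prod e f) (x, y).
have [x1 [x2 xx]] := diam_attained e x; have [y1 [y2 yy]] := diam_attained f y.
apply/eqP; rewrite eqn_leq -{1}pq dist_cart_prod leq_add ?leq_dist_diam //=.
by rewrite -xx -yy -[_ + _](dist_cart_prod (x1, y1) (x2, y2)) leq_dist_diam.
Qed.
End Product.

(** Merging the colors r - 1, ..., s - 1 turns an exact s-coloring into an exact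
    r-coloring, and a progression that is rainbow after merging was so before. *)
Lemma forces_rainbow_mono (V : finType) (e : rel V) k r s : 0 < r -> r <= s ->
  forces_rainbow e k r -> forces_rainbow e k s.
Proof.
case: r => // r _ le_rs F c cS.
have [a|v [ap rb]] := F (fun x => inord (minn (c x) r) : 'I_r.+1).
  have [x cx] := cS (widen_ord le_rs a); exists x; apply: ord_inj.
  by rewrite cx inordK /=; have := ltn_ord a; lia.
exists v; split=> // i j nij; apply: contra (rb i j nij) => /eqP E.
by rewrite E.
Qed.

(** * The anti-van der Waerden number *)

(** With A, B and A', B' as in [tree_diametral_classes], the coloring with
    classes A x A', B x B' and the rest has no rainbow progression. *)
Lemma tree_prod_not_forces_three (V V' : finType) (e : rel V) (e' : rel V')
  (treeT : tree e) (treeT' : tree e')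
  (not3T : ~ peripheral e 3) (not3T' : ~ peripheral e' 3)
  (cardT : 2 <= #|V|) (cardT' : 2 <= #|V'|)
  (odd_diam : odd (diam (cart_prod e e'))) :
  ~ forces_rainbow (cart_prod e e') 3 3.
Proof.
have [_ connV _] := treeT; have [_ connW _] := treeT'.
have [A [B [[a aA aNB] [b bB] AB BA]]] := tree_diametral_classes treeT not3T cardT.
have [A' [B' [[a' aA' aNB'] [b' bB'] AB' BA']]] :=
  tree_diametral_classes treeT' not3T' cardT'.
have distE := dist_cart_prod connV connW.
have diamE : diam (cart_prod e e') = diam e + diam e'.
  exact: diam_cart_prod connV connW a a'.
have bm := tree_bipartite_metric treeT; have bm' := tree_bipartite_metric treeT'.
set D := dist (cart_prod e e') in distE; set N := diam _ in odd_diam diamE.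
(* R and S are the red and the blue vertices. *)
pose R p := (p.1 \in A) && (p.2 \in A'); pose S p := (p.1 \in B) && (p.2 \in B').
have sumN p q :
    (D p q == N) = (dist e p.1 q.1 == diam e) && (dist e' p.2 q.2 == diam e').
  rewrite distE diamE; have := leq_dist_diam e p.1 q.1.
  by have := leq_dist_diam e' p.2 q.2; lia.
have RS p q : R p -> (D p q == N) = S q.
  by case/andP=> p1 p2; rewrite sumN /S (AB _ p1) (AB' _ p2).
have SR p q : S p -> (D p q == N) = R q.
  by case/andP=> p1 p2; rewrite sumN /R (BA _ p1) (BA' _ p2).
have parity p q r : odd (D p r) = odd (D p q) (+) odd (D q r).
  rewrite !distE !oddD (bm_parity bm p.1 q.1 r.1) (bm_parity bm' p.2 q.2 r.2).
  by rewrite addbACA.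
have Dsym p q : D p q = D q p.
  by rewrite !distE (bm_sym bm p.1) (bm_sym bm' p.2).
move=> F.
pose col p : 'I_3 := if R p then inord 0 else if S p then inord 1 else inord 2.
have colE p : col p = (if R p then 0 else if S p then 1 else 2) :> nat.
  by rewrite /col; case: ifP => _; [|case: ifP => _]; rewrite inordK.
have [i|v [[n dn] rb]] := F col.
  have [p pE] : exists p, col p = i :> nat.
    case: i => [[|[|[|//]]] /= _].
    - by exists (a, a'); rewrite colE /R aA aA'.
    - exists (b, b'); rewrite colE /R /S /= bB bB' /= (BA _ bB).
      by rewrite (bm_refl bm) -(bm_refl bm a) -(AB _ aA) (negbTE aNB).
    - exists (a, b'); rewrite colE /R /S /= (negbTE aNB) (BA' _ bB').
      by rewrite (bm_refl bm') -(bm_refl bm' a') -(AB' _ aA') (negbTE aNB') andbF.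
  by exists p; apply: ord_inj.
have d01 := dn ord0 (inord 1) ltac:(by rewrite inordK).
have d12 := dn (inord 1) ord_max ltac:(by rewrite inordK).
have ncol (i j : 'I_3) : i != j -> col (v i) <> col (v j) :> nat.
  by move=> nij /ord_inj/eqP; apply/negP/rb.
have := ncol ord0 (inord 1) ltac:(by rewrite -val_eqE /= inordK).
have := ncol (inord 1) ord_max ltac:(by rewrite -val_eqE /= inordK).
have := ncol ord0 ord_max isT.
move: (v ord0) (v (inord 1)) (v ord_max) d01 d12 => p q r; rewrite -!/D => d01 d12.
rewrite !colE.
(* The ends of a progression are at even distance, so never at distance N. *)
have Dpr := parity p q r; rewrite d01 d12 addbb in Dpr.
have nN : D p r != N by apply: contraFneq Dpr => ->.
have := RS p r; have := SR p r; have := RS q p;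
have := RS q r; have := SR q p; have := SR q r.
rewrite (Dsym q p) d01 d12 (negbTE nN).
by case: (R p) (S p) (R q) (S q) (R r) (S r) => [] [] [] [] [] [];
  case: (n == N) => //; intuition.
Qed.

Lemma tree_prod_forces_four (V V' : finType) (e : rel V) (e' : rel V')
    (treeT : tree e) (treeT' : tree e') (cardT : 1 < #|V|) (cardT' : 1 < #|V'|) :
  forces_rainbow (cart_prod e e') 3 4.
Proof.
move=> c cS.
have [_ connV _] := treeT; have [_ connW _] := treeT'.
have distE := dist_cart_prod connV connW.
have [x0 _] : exists x0 : V, x0 \in V by apply/card_gt0P; apply: ltnW.
have [y0 _] : exists y0 : V', y0 \in V' by apply/card_gt0P; apply: ltnW.
apply: contrapT => norb.
apply: (@four_values_not_rainbow_free _ _ _ _ _ (tree_bipartite_metric treeT)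
  (tree_bipartite_metric treeT') (tree_neighbor treeT cardT)
  (tree_neighbor treeT' cardT') (fun x y => c (x, y)) x0 y0).
  move=> a1 a2 a3.
  have /card_gt0P[k] : 0 < #|~: [set a1; a2; a3]|.
    have := cardsC [set a1; a2; a3]; rewrite card_ord.
    by have := cards2 a1 a2; have := cardsU1 a3 [set a1; a2]; rewrite setUC; lia.
  rewrite !inE !negb_or => /andP[/andP[/eqP n1 /eqP n2] /eqP n3].
  by have [[x y] cxy] := cS k; exists x, y; rewrite cxy.
move=> x1 y1 x2 y2 x3 y3 dE; rewrite /not_rainbow; apply: contrapT => nr.
apply: norb; exists (fun i : 'I_3 => nth (x1, y1) [:: (x1, y1); (x2, y2); (x3, y3)] i).
split.
  exists (dist e x1 x2 + dist e' y1 y2).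
  by case=> [[|[|[|//]]] ?] [[|[|[|//]]] ?] //= _; rewrite distE.
case=> [[|[|[|//]]] ?] [[|[|[|//]]] ?] //= _; apply/eqP; intuition.
Qed.

Theorem theorem4p3 (V V' : finType) (e : rel V) (e' : rel V')
  (treeT : tree e) (treeT' : tree e')
  (not3T : ~ peripheral e 3) (not3T' : ~ peripheral e' 3)
  (cardT : 2 <= #|V|) (cardT' : 2 <= #|V'|)
  (odd_diam : odd (diam (cart_prod e e'))) :
  aw (cart_prod e e') 3 = 4.
Proof.
apply/awP; split=> // [|s s0 sF]; first exact: tree_prod_forces_four.
have no3 :=
  tree_prod_not_forces_three treeT treeT' not3T not3T' cardT cardT' odd_diam.
rewrite leqNgt; apply/negP=> s_lt; apply: no3.
exact: forces_rainbow_mono s0 _ sF.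
Qed.
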